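(* For every integer $m \geq 1$, the integer $U_m = 23\cdot 2^m + 7$ satisfies $\ell(2^{U_m}-1) \leq \ell(U_m) + U_m - 1$; that is, the Scholz conjecture holds for all integers of the form $U_m = 23\cdot 2^m+7$ with $m\ge 1$.
   Context: An addition chain for a positive integer $n$ is a finite sequence $a_0=1, a_1, a_2, \ldots, a_r$ of positive integers with $a_r = n$ such that every element $a_k$ with $k \geq 1$ is the sum $a_i + a_j$ of two previous elements ($0 \le i, j < k$, with $i=j$ allowed). The integer $r$ is the length of the chain. For a positive integer $n$, $\ell(n)$ denotes the minimal length of all addition chains for $n$. The Scholz conjecture is said to hold for a positive integer $n$ if $\ell(2^n-1) \leq \ell(n) + n - 1$. *)

(* Defs.v *)
From mathcomp Require Import all_boot.
From mathcomp Require Import boolp.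

Set Implicit Arguments.
Unset Strict Implicit.
Unset Printing Implicit Defensive.

(* [a] is the whole sequence a_0, ..., a_r, so its length as a chain is
   r = (size a).-1; the first clause excludes the empty sequence. *)
Definition addition_chain (n : nat) (a : seq nat) : Prop :=
  [/\ nth 0 a 0 = 1,
      last 0 a = n,
      forall k, k < size a -> 0 < nth 0 a k
    & forall k, 0 < k < size a ->
        exists i j, [/\ i < k, j < k & nth 0 a k = nth 0 a i + nth 0 a j]].

Definition has_chain (n r : nat) : Prop :=
  exists2 a, addition_chain n a & (size a).-1 = r.

(* The value 0 at n = 0, which has no addition chain, is a dummy. *)
Definition ell (n : nat) : nat :=
  if pselect (exists r, `[< has_chain n r >]) is left ex_r then ex_minn ex_r
  else 0.

Definition scholz (n : nat) : Prop := ell (2 ^ n - 1) <= ell n + n - 1.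

Lemma has_chain_pred n : 0 < n -> has_chain n n.-1.
Proof.
case: n => // n _; exists (iota 1 n.+1); last by rewrite size_iota.
split=> // [|k|k].
- by rewrite -nth_last size_iota nth_iota.
- by rewrite size_iota => kn; rewrite nth_iota.
- rewrite size_iota => /andP[k0 kn]; exists k.-1, 0.
  have k1 : k.-1 < k by rewrite prednK.
  by split=> //; rewrite !nth_iota ?(ltn_trans k1) // !add1n prednK // addn1.
Qed.

Lemma ellP n : 0 < n ->
  has_chain n (ell n) /\ (forall r, has_chain n r -> ell n <= r).
Proof.
move=> n0; rewrite /ell; case: pselect => [ex_r|[]]; last first.
  by exists n.-1; apply/asboolP; exact: has_chain_pred.
case: ex_minnP => r /asboolP hr rmin; split=> // s hs.
by apply: rmin; apply/asboolP.
Qed.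

(* Main.v *)
Require Import Defs.
From Stdlib Require Import NArith Lia List.
From mathcomp Require Import all_boot.
From mathcomp Require Import boolp.
From mathcomp Require Import zify.

Set Implicit Arguments.
Unset Strict Implicit.
Unset Printing Implicit Defensive.

(* A star chain n, ..., 1, in which every element uses its predecessor, gives
   a chain for 2^n - 1: from 2^a - 1 one reaches 2^(a + b) - 1 by b doublings
   and the addition of 2^b - 1. Hence scholz n holds as soon as some star chain
   for n has length ell n. The chain 1, 2, 3, 4, 7, 8, 16, 23, 46, ...,
   23 * 2^m, 23 * 2^m + 7 has length m + 8, and it remains to see that no chain
   for n = 23 * 2^m + 7 is shorter when m >= 5 (m = 1, 2, 4 need shorter star
   chains).

   A shorter chain has at most three small steps, that is, steps that do not
   pass a power of 2. Call an even element P of a chain a cut if P / 2 is in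
   the chain, 48 P <= n, and the elements from P to 48 P are obtained from P
   without using any smaller element. Then every element x >= P is
   h x * P + l x, where l x is contributed by the "far" elements, which add an
   element smaller than P to one that is at least 47 P. Given a cut, replacing
   P by P / 2 or dropping l yields a shorter chain for a similar number, and
   few elements are far since they are nearly wasted steps, of ratio at most
   48 / 47: this allows an induction on m.
   Chains without cuts, with at most two small steps, are finitely many, and
   are enumerated by a verified search. A third small step is followed by
   large steps only, and since n is odd and just below 24 * 2^m, at most three
   of them. *)

(** * Enumeration of the chains with few small steps *)

Section Search.
Import ListNotations.
Local Open Scope N_scope.

Notation "a &&& b" := (if a then b else false) (at level 40, left associativity).

Fixpoint hasN (f : N -> bool) (l : list N) : bool :=
  match l with [] => false | a :: t => if f a then true else hasN f t end.

Fixpoint allN (f : N -> bool) (l : list N) : bool :=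
  match l with [] => true | a :: t => if f a then allN f t else false end.

Definition memN (x : N) (l : list N) : bool := hasN (N.eqb x) l.

Definition insum (n : N) (l : list N) : bool :=
  hasN (fun a => (n <=? 2 * a) &&& (a <=? n) &&& memN (n - a) l) l.

Fixpoint insertN (x : N) (l : list N) : list N :=
  match l with [] => [x] | a :: t => if N.eqb a x then l else a :: insertN x t end.

Fixpoint sums_with (lo a : N) (l acc : list N) : list N :=
  match l with
  | [] => acc
  | b :: t => let x := a + b in
      sums_with lo a t (if x <? lo then acc else insertN x acc)
  end.

(** As [l] is kept decreasing, [a] is the larger summand and its sums are at most [2 * a], which
    justifies the pruning below [lo]. *)
Fixpoint sums (lo : N) (l acc : list N) : list N :=
  match l with
  | [] => acc
  | a :: t => sums lo t (if 2 * a <? lo then acc else sums_with lo a l acc)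
  end.

(* A necessary condition for [n], odd, to be reached from [l], whose maximum is
   [top], in [r + 1] increasing steps. As the last step cannot be a doubling,
   an element that is followed by [r + 2] of these steps is at least
   [n / (3 * 2 ^ r)]. *)
Fixpoint reach (r : nat) (top n : N) (l : list N) : bool :=
  match r with
  | O => insum n l
  | S r' => match r' with
     | O => if insum n l then true else
            hasN (fun y => let z := n - y in
                    (top <? z) &&& (z <=? 2 * top) &&& insum z l) l
     | S r'' => hasN (fun x => (x <? n) &&& reach r' x n (x :: l))
                 (sums (N.max (top + 1) (N.div n (N.shiftl 3 (N.of_nat r'')))) l [])
     end
  end.

Definition high_sum (P x : N) (l : list N) : bool :=
  hasN (fun a => (P <=? a) &&& (P + a <=? x) &&& memN (x - a) l) l.

Definition cut_at (P : N) (l : list N) : bool :=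
  N.even P &&& memN (N.div2 P) l &&&
  allN (fun x => if (P <? x) &&& (x <=? 48 * P) then high_sum P x l else true) l.

(* [prev] is the previous value of [top], for which the smaller [P] were tested. *)
Definition has_cut (top prev : N) (l : list N) : bool :=
  hasN (fun P => (48 * P <=? top) &&& (prev <? 48 * P) &&& cut_at P l) l.

(* With [pw = 32 * u], the element [x] is not between [21 * u] and [23.4 * u] if
   there are [e < 2] small steps, and is [23 * u] if it is between [22.506 * u]
   and [23.4 * u] and there are [e = 2] small steps. *)
Definition range_check (e pw x : N) : bool :=
  if (if e <? 2 then 21000 else 22506) * pw <? 32000 * x then
    if 32000 * x <? 23400 * pw then
      if e =? 2 then 32 * x =? 23 * pw else false
    else true
  else true.

(* For [pw = 2 ^ (m + 5)], the number [23 * 2 ^ m + 7]. *)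
Definition target (pw : N) : N := 23 * N.shiftr pw 5 + 7.

(* No small step followed by at most three large ones leads to a target. The
   targets below 1400 are irrelevant, as only [m >= 6] matters here. *)
Definition completion_check (l : list N) (top pw : N) : bool :=
  let n0 := target pw in let n1 := target (2 * pw) in
  let n2 := target (4 * pw) in let n3 := target (8 * pw) in
  (if n0 <? 1400 then true else
     if top <? n0 then if insum n0 l then false else true else true) &&&
  (if n1 <? 1400 then true else
     if insum n1 l then false else
     allN (fun y => let z := n1 - y in
             if (top <? z) &&& (z <? pw) then if insum z l then false else true
             else true) l) &&&
  allN (fun z => if z <? pw then
          (if n2 <? 1400 then true else if reach 1 z n2 (z :: l) then false else true) &&&
          (if n3 <? 1400 then true else if reach 2 z n3 (z :: l) then false else true)
        else true)
       (sums (N.max (top + 1) (N.div n3 6)) l []).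

(** With [e = 2] only large steps are generated; a third small step is left to [completion_check].
    Running out of fuel counts as failure, so success means that every branch ends in a cut. *)
Fixpoint search (fuel : nat) (l : list N) (top prev pw e : N) : bool :=
  match fuel with
  | O => false
  | S f =>
    if has_cut top prev l then true else
    range_check e pw top &&&
    (if e =? 2 then completion_check l top pw else true) &&&
    allN (fun x => if x <? pw then search f (x :: l) x top pw (e + 1)
                   else search f (x :: l) x top (2 * pw) e)
      (sums (if e =? 2 then pw else top + 1) l [])
  end.

Lemma search_true : search 100 [1] 1 1 2 0 = true.
Proof. by vm_cast_no_check (erefl true). Qed.

Definition unreachable (n : N) (k : nat) : bool :=
  forallb (fun r => negb (reach r 1 n [1])) (List.seq 0 k).

(** These are the targets for [m] from 1 to 5: the first four are treated separately, and 743 starts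
    the induction of [target_bound]. *)
Lemma unreachable_true :
  [&& unreachable 53 7, unreachable 99 7, unreachable 191 10, unreachable 375 10
    & unreachable 743 12].
Proof. by vm_cast_no_check (erefl true). Qed.

(** * Correctness of the list operations and completeness of [reach] *)

Lemma hasN_P f l : hasN f l = true <-> exists2 a, In a l & f a = true.
Proof.
elim: l => [|a l IH] /=; first by split=> // -[].
case: ifP => fa; first by split=> // _; exists a; [left|].
rewrite IH; split=> [[b bl fb]|[b [<-|bl] fb]]; first by exists b; [right|].
- by rewrite fa in fb.
- by exists b.
Qed.

Lemma allN_P f l : allN f l = true <-> forall a, In a l -> f a = true.
Proof.
elim: l => [|a l IH] /=; first by split.
case: ifP => fa; last by split=> // /(_ a (or_introl erefl)); rewrite fa.
rewrite IH; split=> [fl b [<-|/fl]//|fl b bl]; by apply: fl; right.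
Qed.

Lemma memN_P x l : memN x l = true <-> In x l.
Proof.
rewrite /memN hasN_P; split=> [[a al /N.eqb_spec ->]//|xl].
by exists x => //; apply/N.eqb_spec.
Qed.

Lemma insum_complete a b l : In a l -> In b l -> insum (a + b) l = true.
Proof.
wlog ba : a b / b <= a => [wl al bl|al bl].
  case: (N.le_ge_cases a b) => ?; [rewrite N.add_comm|]; exact: wl.
apply/hasN_P; exists a => //.
have -> : (a + b <=? 2 * a) = true by apply/N.leb_spec0; lia.
have -> : (a <=? a + b) = true by apply/N.leb_spec0; lia.
by apply/memN_P; have -> : a + b - a = b by lia.
Qed.

Lemma In_insertN x y l : In y (insertN x l) <-> y = x \/ In y l.
Proof.
elim: l => [|a l IH] /=; first by split=> -[]; auto.
case: (N.eqb_spec a x) => [->|_] /=; first by split; intuition congruence.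
rewrite IH; intuition congruence.
Qed.

Lemma In_sums_with_acc lo a l acc y : In y acc -> In y (sums_with lo a l acc).
Proof.
elim: l acc => [//|b l IH] acc yacc /=; apply: IH.
by case: ifP => // _; apply/In_insertN; right.
Qed.

Lemma In_sums_with lo a l acc b : In b l -> lo <= a + b ->
  In (a + b) (sums_with lo a l acc).
Proof.
elim: l acc => [//|c l IH] acc /= [<- lo_ab|bl]; last exact: IH.
apply: In_sums_with_acc; case: N.ltb_spec => H; first lia.
by apply/In_insertN; left.
Qed.

Lemma In_sums_acc lo l acc y : In y acc -> In y (sums lo l acc).
Proof.
elim: l acc => [//|a l IH] acc yacc; apply: IH.
by case: ifP => // _; apply: In_sums_with_acc.
Qed.

Fixpoint desc (l : list N) : Prop :=
  match l with [] => True | a :: t => (forall b, In b t -> b < a) /\ desc t end.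

Lemma In_sums lo l acc a b : desc l -> In a l -> In b l -> lo <= a + b ->
  In (a + b) (sums lo l acc).
Proof.
have gen c d m ac : (forall x, In x m -> x < c) -> In d (c :: m) -> lo <= c + d ->
    In (c + d) (sums lo m (if 2 * c <? lo then ac else sums_with lo c (c :: m) ac)).
  move=> mc dm lo_cd; apply: In_sums_acc; case: N.ltb_spec => H; last exact: In_sums_with.
  by exfalso; case: dm => [?|/mc ?]; lia.
elim: l acc => [//|c l IH] acc [lc dl] [<-|al] bl lo_ab; first exact: gen.
case: bl lo_ab => [<-|bl] lo_ab; last exact: IH.
by rewrite N.add_comm in lo_ab *; apply: gen => //; right.
Qed.

(* [reaches l r n]: [r + 1] further increasing steps lead from the list [l] to [n]. *)
Inductive reaches : list N -> nat -> N -> Prop :=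
| reaches0 l a b : In a l -> In b l -> (forall y, In y l -> y < a + b) -> reaches l 0 (a + b)
| reachesS l a b r n : In a l -> In b l -> (forall y, In y l -> y < a + b) ->
    reaches (a + b :: l) r n -> reaches l r.+1 n.

Lemma reaches_gt l r n : reaches l r n -> forall y, In y l -> y < n.
Proof.
elim=> {l r n} [//|l a b r n al bl lt_ab _ IH y yl].
by apply: IH; right.
Qed.

(** Each step at most doubles the maximum. The last one, leading to an odd number, does not double
    the newest element, so the last two steps together gain at most a factor 3. *)
Lemma reaches_bound l r n : reaches l r n -> N.odd n ->
  forall t, (forall y, In y l -> y <= t) ->
  n <= match r with O => 2 * t | S r' => 3 * 2 ^ N.of_nat r' * t end.
Proof.
elim=> {l r n} [l a b al bl _ _ t lt|l a b r n al bl ltab pn IH on t lt].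
  by have := lt _ al; have := lt _ bl; lia.
have ab2 : a + b <= 2 * t by have := lt _ al; have := lt _ bl; lia.
have lt' y : In y (a + b :: l) -> y <= a + b by case=> [<-|/ltab]; lia.
case: r pn IH => [|r] pn IH; last first.
  have := IH on _ lt'; rewrite Nat2N.inj_succ N.pow_succ_r'; nia.
move: on; inversion pn as [l' c d cl dl ltcd|] => {IH}; subst => ocd.
rewrite N.pow_0_r.
case: cl => [Ec|cl]; case: dl => [Ed|dl].
- by subst; have := N.odd_spec (a + b + (a + b)) => -[/(_ ocd) [k]]; lia.
- by have := lt _ dl; lia.
- by have := lt _ cl; lia.
- by have := lt _ cl; have := lt _ dl; lia.
Qed.

Lemma reach_complete l r n t : reaches l r n -> N.odd n -> desc l -> In t l ->
  (forall y, In y l -> y <= t) -> reach r t n l = true.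
Proof.
move=> pn; elim: pn t => {l r n} [l a b al bl _ t _ _ _ _|].
  exact: insum_complete.
move=> l a b r n al bl ltab pn IH t on dl tl lt.
have lt' y : In y (a + b :: l) -> y <= a + b by case=> [<-|/ltab]; lia.
have dl' : desc (a + b :: l) by [].
have ab2 : a + b <= 2 * t by have := lt _ al; have := lt _ bl; lia.
case: r pn IH => [|r] pn IH.
  rewrite /=; case: ifP => // /negP ins; apply/hasN_P.
  inversion pn as [l' c d cl dl0 ltcd|]; subst.
  (* The last step uses the new element [a + b] once, since twice would be even; [y] is the other
     summand. *)
  have key y : In y l -> c + d = a + b + y ->
      exists2 y0 : N, In y0 l & (let z := c + d - y0 in
        (if if t <? z then z <=? 2 * t else false then insum z l else false)) = true.
    move=> yl E; exists y => //=.
    have -> : c + d - y = a + b by lia.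
    have -> : (t <? a + b) = true by apply/N.ltb_spec0; exact: ltab.
    have -> : (a + b <=? 2 * t) = true by apply/N.leb_spec0.
    exact: insum_complete.
  case: cl => [Ec|cl]; case: dl0 => [Ed|dl0].
  - by subst; have := N.odd_spec (a + b + (a + b)) => -[/(_ on) [k]]; lia.
  - by apply: (key d) => //; lia.
  - by apply: (key c) => //; lia.
  - by case: ins; apply: insum_complete.
have -> : reach r.+2 t n l = hasN (fun x => if x <? n then reach r.+1 x n (x :: l) else false)
    (sums (N.max (t + 1) (N.div n (N.shiftl 3 (N.of_nat r)))) l []) by [].
apply/hasN_P; exists (a + b).
  apply: In_sums => //; apply: N.max_lub; first by have := ltab _ tl; lia.
  have := reaches_bound pn on lt'; rewrite N.shiftl_mul_pow2 => H.
  have p0 : 0 < 3 * 2 ^ N.of_nat r by have := N.pow_nonzero 2 (N.of_nat r); lia.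
  apply: N.Div0.div_le_upper_bound; lia.
have -> : (a + b <? n) = true by apply/N.ltb_spec0; apply: (reaches_gt pn); left.
by apply: IH => //; left.
Qed.

(* [chain l pw e]: [l] is a chain in decreasing order, [pw] the least power of
   2 above its head, and [e] the number of steps that stay below the power of
   2 above the previous element. *)
Inductive chain : list N -> N -> N -> Prop :=
| chain1 : chain [1] 2 0
| chain_small l pw e a b : chain l pw e -> In a l -> In b l ->
    (forall y, In y l -> y < a + b) -> a + b < pw -> chain (a + b :: l) pw (e + 1)
| chain_big l pw e a b : chain l pw e -> In a l -> In b l ->
    (forall y, In y l -> y < a + b) -> pw <= a + b -> chain (a + b :: l) (2 * pw) e.

(** The condition is imposed at every tail, so that the cut test of [search] discards no stage of
    the chain. *)
Fixpoint irreducible (l : list N) : Prop :=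
  match l with
  | [] => True
  | x :: t => (forall P, In P l -> 48 * P <= x -> cut_at P l = false) /\ irreducible t
  end.

Definition top (l : list N) : N := List.hd 0 l.

Lemma chain_desc l pw e : chain l pw e -> desc l.
Proof. by elim=> {l pw e} //=. Qed.

Lemma chain_lt l pw e : chain l pw e -> forall y, In y l -> y < pw.
Proof.
elim=> {l pw e} [y [<-|]//|l pw e a b _ _ al bl lt ab y|l pw e a b _ IH al bl lt ab y].
  by case=> [<-|/lt ?] //; lia.
have := IH _ al; have := IH _ bl.
by move=> ? ? [<-|/IH ?]; lia.
Qed.

Lemma chain_top l pw e : chain l pw e -> In (top l) l /\ pw <= 2 * top l.
Proof.
elim=> {l pw e} [|l pw e a b _ [tl IH] _ _ lt _|l pw e a b _ _ _ _ _ ab].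
- by split; [left|].
- split; first by left.
  by have := lt _ tl; change (top (a + b :: l)) with (a + b); lia.
- by split; [left|change (top (a + b :: l)) with (a + b); lia].
Qed.

Lemma searchE f l prev pw e : irreducible l ->
  search f l (top l) prev pw e = true ->
  [/\ range_check e pw (top l) = true,
      e = 2 -> completion_check l (top l) pw = true
    & forall x, In x (sums (if e =? 2 then pw else top l + 1) l []) ->
      exists f', (if x <? pw then search f' (x :: l) x (top l) pw (e + 1)
                  else search f' (x :: l) x (top l) (2 * pw) e) = true].
Proof.
case: f => //= f irr.
case: ifP => [/hasN_P[P Pl]|_].
  case: N.leb_spec => // PL; case: ifP => // _ cutP.
  case: l irr Pl PL cutP => // x l [irr _] Pl PL.
  by rewrite irr.
case: (range_check _ _ _) => //.
case: ifP => // chk /allN_P ch; split=> //.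
  by move=> e2; move: chk; rewrite e2.
by move=> x xl; exists f; exact: ch.
Qed.

(** The chain is followed down the search tree from [search_true]; the fuel left and [prev] vary
    along the path. *)
Lemma search_complete l pw e : chain l pw e -> irreducible l -> e <= 2 ->
  exists f prev, search f l (top l) prev pw e = true.
Proof.
elim=> {l pw e} [_ _|l pw e a b cl IH al bl lt ab|l pw e a b cl IH al bl lt ab].
- by exists 100%nat, 1; exact: search_true.
- move=> [_ irr] e2; have [|f [prev]] := IH irr; first lia.
  case/(searchE irr) => _ _ /(_ (a + b)).
  have -> : (e =? 2) = false by apply/N.eqb_neq; lia.
  have -> : (a + b <? pw) = true by apply/N.ltb_spec0.
  case=> [|f' Hf]; last by exists f', (top l).
  apply: In_sums (chain_desc cl) al bl _.
  by have [tl _] := chain_top cl; have := lt _ tl; lia.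
- move=> [_ irr] e2; have [|f [prev]] := IH irr; first lia.
  case/(searchE irr) => _ _ /(_ (a + b)).
  have -> : (a + b <? pw) = false by apply/N.ltb_ge.
  case=> [|f' Hf]; last by exists f', (top l).
  apply: In_sums (chain_desc cl) al bl _.
  have [tl _] := chain_top cl; have := lt _ tl.
  by case: (e =? 2); lia.
Qed.

Lemma irreducible_range l pw e : chain l pw e -> irreducible l -> e <= 2 ->
  range_check e pw (top l) = true.
Proof.
move=> cl irr e2; have [f [prev]] := search_complete cl irr e2.
by case/(searchE irr).
Qed.

Lemma irreducible_completion l pw : chain l pw 2 -> irreducible l ->
  completion_check l (top l) pw = true.
Proof.
move=> cl irr; have [f [prev]] := search_complete cl irr (N.le_refl 2).
by case/(searchE irr) => _ ->.
Qed.

Inductive big_steps (l0 : list N) (pw0 : N) : list N -> N -> nat -> Prop :=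
| big_steps0 : big_steps l0 pw0 l0 pw0 0
| big_stepsS l pw t a b : big_steps l0 pw0 l pw t -> In a l -> In b l ->
    (forall y, In y l -> y < a + b) -> pw <= a + b ->
    big_steps l0 pw0 (a + b :: l) (2 * pw) t.+1.

Lemma big_steps_lt l0 pw0 l pw t : (forall y, In y l0 -> y < pw0) ->
  big_steps l0 pw0 l pw t -> forall y, In y l -> y < pw.
Proof.
move=> lt0; elim=> {l pw t} [//|l pw t a b _ IH al bl lt ab y].
have := IH _ al; have := IH _ bl.
by move=> ? ? [<-|/IH ?]; lia.
Qed.

Lemma big_steps_inv l0 pw0 l pw t : big_steps l0 pw0 l pw t ->
  if t is t'.+1 then
    exists l' pw' a b, [/\ l = a + b :: l', pw = 2 * pw', big_steps l0 pw0 l' pw' t',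
      In a l' /\ In b l' & (forall y, In y l' -> y < a + b) /\ pw' <= a + b]
  else l = l0 /\ pw = pw0.
Proof. by case=> // {}l {}pw {}t a b *; exists l, pw, a, b. Qed.

Lemma third_small_step l pw e : chain l pw e -> e = 3 -> irreducible l ->
  exists l0 pw0 a b t, [/\ chain l0 pw0 2 /\ irreducible l0, In a l0 /\ In b l0,
    forall y, In y l0 -> y < a + b, a + b < pw0
    & big_steps (a + b :: l0) pw0 l pw t].
Proof.
elim=> {l pw e} [//|l pw e a b cl IH al bl lt ab e3 [_ irr]
  |l pw e a b _ IH al bl lt ab e3 [_ irr]].
  have e2 : e = 2 by lia.
  by rewrite e2 in cl; exists l, pw, a, b, 0%nat; split=> //; exact: big_steps0.
have [l0 [pw0 [c [d [t [? ? ? ? bs]]]]]] := IH e3 irr.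
by exists l0, pw0, c, d, t.+1; split=> //; exact: big_stepsS.
Qed.

Lemma targetE U : target (32 * U) = 23 * U + 7.
Proof.
by rewrite /target N.shiftr_div_pow2 [32 * U]N.mul_comm N.div_mul.
Qed.

Lemma completion_checkE l t pw : completion_check l t pw = true ->
  [/\ 1400 <= target pw -> t < target pw -> insum (target pw) l = false,
      1400 <= target (2 * pw) -> insum (target (2 * pw)) l = false /\
        forall y, In y l -> t < target (2 * pw) - y < pw ->
          insum (target (2 * pw) - y) l = false
    & forall z, In z (sums (N.max (t + 1) (target (8 * pw) / 6)) l []) -> z < pw ->
        (1400 <= target (4 * pw) -> reach 1 z (target (4 * pw)) (z :: l) = false) /\
        (1400 <= target (8 * pw) -> reach 2 z (target (8 * pw)) (z :: l) = false)].
Proof.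
rewrite /completion_check; cbv zeta.
have andE (a b : bool) : (if a then b else false) = true -> a = true /\ b = true.
  by case: a.
have notE (a : bool) : (if a then false else true) = true -> a = false by case: a.
move=> /andE[/andE[chk0 chk1] /allN_P chk23]; split=> [ge0 lt_t|ge1|z zl zpw].
- move: chk0; case: N.ltb_spec => [|_]; first lia.
  by case: N.ltb_spec => [_ /notE//|]; lia.
- move: chk1; case: N.ltb_spec => [|_]; first lia.
  case: ifP => // ins /allN_P chk; split=> // y yl [ty ypw].
  have := chk _ yl.
  by case: N.ltb_spec => [_|]; last lia; case: N.ltb_spec => [_ /notE//|]; lia.
- have := chk23 _ zl; case: N.ltb_spec => [_ /andE[chk2 chk3]|]; last lia.
  split=> ge; [move: chk2|move: chk3]; case: N.ltb_spec => [|_ /notE//]; lia.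
Qed.

(** With at most two small steps, [range_check] leaves only [23 * U] in this range. With three,
    [completion_check] excludes up to three final large steps, and parity excludes more. The bound
    on [U] puts the target above 1400 and below [23.4 * U]. *)
Lemma irreducible_target l pw e U : chain l pw e -> irreducible l -> e <= 3 ->
  64 <= U -> N.even U -> pw = 32 * U -> top l <> 23 * U + 7.
Proof.
move=> cl irr e3 U64 evU pwE topE.
have [e2|e2] := N.le_gt_cases e 2.
  have := irreducible_range cl irr e2; rewrite /range_check topE pwE.
  case: N.ltb_spec => [_|]; last by case: (e <? 2); lia.
  case: N.ltb_spec => [_|]; last lia.
  by case: (e =? 2) => // /N.eqb_spec; lia.
have {e2 e3} e3 : e = 3 by lia.
have on : N.odd (23 * U + 7).
  by rewrite N.odd_add N.odd_mul -(N.negb_even U) evU.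
have [l0 [pw0 [a [b [t [[cl0 irr0] [al bl] lt ab bs]]]]]] := third_small_step cl e3 irr.
have lt1 y : In y (a + b :: l0) -> y < pw0.
  by case=> [<-|/(chain_lt cl0)].
have [chk0 chk1 chk23] := completion_checkE (irreducible_completion cl0 irr0).
have dl1 : desc (a + b :: l0) by split; [|exact: chain_desc cl0].
have [tl0 top0] := chain_top cl0.
have topab := lt _ tl0.
have in0 := insum_complete al bl.
have inz : target (8 * pw0) / 6 <= a + b ->
    In (a + b) (sums (N.max (top l0 + 1) (target (8 * pw0) / 6)) l0 []).
  move=> lo; apply: In_sums (chain_desc cl0) al bl _.
  by apply: N.max_lub => //; lia.
have odd_double x : 23 * U + 7 <> x + x.
  by move=> E; move: on; rewrite E N.odd_add; case: (N.odd x).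
have le1 y : In y (a + b :: l0) -> y <= a + b by case=> [<-|/lt]; lia.
case: t bs => [|t] /big_steps_inv.
  case=> lE pwE'; subst l; change (top (a + b :: l0)) with (a + b) in topE.
  move: in0; rewrite topE -targetE -pwE pwE' chk0 // -pwE' pwE targetE; lia.
case=> [l1 [pw1 [a1 [b1 [lE pwE' bs [al1 bl1] [ltn1 ge1]]]]]]; subst l.
have lt_pw1 := big_steps_lt lt1 bs.
change (top (a1 + b1 :: l1)) with (a1 + b1) in topE.
case: t bs => [|t] /big_steps_inv.
  case=> l1E pw1E; subst l1 pw1; move: chk1; rewrite -pwE' pwE targetE -topE.
  case; first lia.
  have last y : In y l0 -> a1 + b1 = a + b + y -> insum (a1 + b1 - y) l0 = false ->
     False.
    by move=> yl E; have -> : a1 + b1 - y = a + b by [lia]; rewrite in0 => ?; congruence.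
  move=> ins0 ins1; case: al1 ltn1 => [Ea|al1]; case: bl1 => [Eb|bl1] ltn1.
  - by apply: (odd_double (a + b)); rewrite -topE -Ea -Eb.
  - by apply: (last b1) => //; [lia|apply: ins1 => //; lia].
  - by apply: (last a1) => //; [lia|apply: ins1 => //; lia].
  - by rewrite insum_complete in ins0.
case=> [l2 [pw2 [a2 [b2 [l1E pw1E bs [al2 bl2] [ltn2 ge2]]]]]]; subst l1.
have lt_pw2 := big_steps_lt lt1 bs.
have re1 : reaches (a2 + b2 :: l2) 0 (23 * U + 7) by rewrite -topE; exact: reaches0.
have re2 := reachesS al2 bl2 ltn2 re1.
case: t bs => [|t] /big_steps_inv.
  case=> l2E pw2E; subst l2 pw2.
  have tE : target (4 * pw0) = 23 * U + 7.
    by rewrite -targetE -pwE pwE' pw1E N.mul_assoc.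
  (* Two steps from [a + b] reach at most [3 * (a + b)], and the next target is less than twice this
     one, whence the divisor 6. *)
  have lo : target (8 * pw0) / 6 <= a + b.
    have -> : 8 * pw0 = 32 * (2 * U) by lia.
    rewrite targetE; apply: N.Div0.div_le_upper_bound.
    by have := reaches_bound re2 on le1; rewrite N.pow_0_r; lia.
  have [ch _] := chk23 _ (inz lo) ab; rewrite tE in ch.
  have := reach_complete re2 on dl1 (or_introl erefl) le1.
  by rewrite ch //; lia.
case=> [l3 [pw3 [a3 [b3 [l2E pw2E bs [al3 bl3] [ltn3 ge3]]]]]]; subst l2.
have lt_pw3 := big_steps_lt lt1 bs.
have re3 := reachesS al3 bl3 ltn3 re2.
case: t bs => [|t] /big_steps_inv.
  case=> l3E pw3E; subst l3 pw3.
  have tE : target (8 * pw0) = 23 * U + 7.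
    by rewrite -targetE; congr target; lia.
  have lo : target (8 * pw0) / 6 <= a + b.
    rewrite tE; apply: N.Div0.div_le_upper_bound.
    have := reaches_bound re3 on le1.
    by change (2 ^ N.of_nat 1) with 2; lia.
  have [_ ch] := chk23 _ (inz lo) ab; rewrite tE in ch.
  have := reach_complete re3 on dl1 (or_introl erefl) le1.
  by rewrite ch //; lia.
case=> [l4 [pw4 [a4 [b4 [l3E pw3E bs [al4 bl4] [ltn4 ge4]]]]]]; subst l3.
have lt_pw4 := big_steps_lt lt1 bs.
(* The target lies just below [24 * U], so each of the last three values is
   forced to be twice or three times its predecessor. *)
set x := a2 + b2 in topE al1 bl1 lt_pw1 *.
set y := a3 + b3 in al2 bl2 al1 bl1 lt_pw1 lt_pw2 *.
set z := a4 + b4 in al3 bl3 al2 bl2 al1 bl1 lt_pw1 lt_pw2 lt_pw3 *.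
have ltx : x < pw1 by apply: lt_pw1; left.
have lty : y < pw2 by apply: lt_pw2; left.
have ltz : z < pw3 by apply: lt_pw3; left.
have small1 c : In c (x :: y :: z :: l4) -> [\/ c = x, c = y | c < pw3].
  by case=> [<-|[<-|[<-|/lt_pw4 ?]]]; [apply: Or31|apply: Or32|apply: Or33|apply: Or33; lia].
have small2 c : In c (y :: z :: l4) -> c = y \/ c < pw3.
  by case=> [<-|[<-|/lt_pw4 ?]]; [left|right|right; lia].
have small3 c : In c (z :: l4) -> c = z \/ c < pw4.
  by case=> [<-|/lt_pw4 ?]; [left|right].
(* Here [x < 16 * U], [y < 8 * U] and older elements are below [4 * U], so only [x + y] and the even
   [x + x] are large enough. *)
have nE : 23 * U + 7 = x + y.
  by case: (small1 _ al1) => ?; case: (small1 _ bl1) => ?; subst; try lia;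
    case: (odd_double x); lia.
have xE : x = y + y.
  by case: (small2 _ al2) => ?; case: (small2 _ bl2) => ?; rewrite /x; lia.
have yE : y = z + z.
  by case: (small3 _ al3) => ?; case: (small3 _ bl3) => ?; rewrite /y; lia.
(* The target would be [6 * z]. *)
by apply: (odd_double (y + z)); lia.
Qed.

End Search.

(** * Decomposition along a cut *)

(** An unordered form of a chain, in which repetitions are allowed, so that images under the maps
    below need no sorting. The size of such a list plays the role of the length plus one. *)
Definition chain_set (S : seq nat) : Prop :=
  [/\ 1 \in S, 0 \notin S
    & forall x, x \in S -> x = 1 \/ exists y z, [/\ y \in S, z \in S & x = y + z]].

Lemma chain_set_gt0 S x : chain_set S -> x \in S -> 0 < x.
Proof. by case=> _ S0 _; case: x => // xS; rewrite xS in S0. Qed.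

Definition cut (S : seq nat) (n P : nat) : Prop :=
  [/\ P \in S, ~~ odd P, P./2 \in S, 48 * P <= n
    & forall x, x \in S -> P < x <= 48 * P ->
      exists a b, [/\ a \in S, b \in S, P <= a, P <= b & x = a + b]].

Definition far (S : seq nat) (P x : nat) : bool :=
  (P < x) && ~~ has (fun a => [&& P <= a, P + a <= x & x - a \in S]) S.

(* The recursive part of a decomposition [x = h x * P + l x], where [l x]
   collects the contributions of the elements below [P]. *)
Definition coord_step (S : seq nat) (P : nat) (h l : nat -> nat) (x : nat) : Prop :=
  if far S P x then
    exists y r, [/\ y \in S, r \in S, r < P, 47 * P <= y
                  & [/\ x = y + r, h x = h y & l x = l y + r]]
  else
    exists y z, [/\ y \in S, z \in S, P <= y, P <= z
                  & [/\ x = y + z, h x = h y + h z & l x = l y + l z]].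

Definition coordinates (S : seq nat) (P : nat) (h l : nat -> nat) : Prop :=
  [/\ h P = 1, l P = 0 & forall x, x \in S -> P < x -> coord_step S P h l x].

Lemma coord_step_ext S P h l h' l' x : chain_set S ->
  (forall t, t < x -> P <= t -> h' t = h t /\ l' t = l t) ->
  h' x = h x -> l' x = l x -> P < x -> coord_step S P h l x -> coord_step S P h' l' x.
Proof.
move=> cS ext hx lx Px; rewrite /coord_step; case: ifP => _ [y [z [yS zS Py Pz [E hE lE]]]].
  have z0 := chain_set_gt0 cS zS; exists y, z; split=> //.
  have [-> ->] := ext y ltac:(lia) ltac:(lia).
  by rewrite hx lx.
have z0 := chain_set_gt0 cS zS; have y0 := chain_set_gt0 cS yS; exists y, z; split=> //.
have [-> ->] := ext y ltac:(lia) ltac:(lia).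
have [-> ->] := ext z ltac:(lia) ltac:(lia).
by rewrite hx lx.
Qed.

(** Values are assigned to successive integers. By the cut property a far element exceeds [48 * P];
    its smaller summand is below [P], so the larger one is at least [47 * P]. *)
Lemma cut_coordinates S n P : chain_set S -> cut S n P ->
  exists h l, coordinates S P h l.
Proof.
move=> cS [PS evP P2S Pn gen].
have P0 := chain_set_gt0 cS PS.
have [k kP] : exists k, forall x, x \in S -> x <= k.
  elim: (S) => [|a s [k IH]]; first by exists 0.
  exists (maxn a k) => x; rewrite inE => /predU1P[->|/IH xk]; first exact: leq_maxl.
  exact: leq_trans xk (leq_maxr _ _).
suff [h [l [hP lP hl]]] : exists h l : nat -> nat, [/\ h P = 1, l P = 0
    & forall x, x \in S -> P < x -> x <= k -> coord_step S P h l x].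
  by exists h, l; split=> // x xS Px; apply: hl => //; exact: kP.
elim: k {kP} => [|k [h [l [hP lP hl]]]].
  by exists (fun=> 1), (fun=> 0); split=> // x _; lia.
have [kP|Pk] := ltnP k P; first by exists h, l; split=> // x xS Px xk; lia.
have extend v w : (k.+1 \in S ->
    coord_step S P (fun t => if t == k.+1 then v else h t)
                   (fun t => if t == k.+1 then w else l t) k.+1) ->
    exists h l : nat -> nat, [/\ h P = 1, l P = 0
      & forall x, x \in S -> P < x -> x <= k.+1 -> coord_step S P h l x].
  move=> new; exists (fun t => if t == k.+1 then v else h t),
    (fun t => if t == k.+1 then w else l t).
  have ne t : t <= k -> (t == k.+1) = false by move=> tk; apply/eqP; lia.
  rewrite !ne //; split=> // x xS Px; rewrite leq_eqVlt => /predU1P[xE|xk].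
    by rewrite xE in xS *; exact: new.
  apply: coord_step_ext (hl x xS Px xk) => //; rewrite ?ne //.
  by move=> t tx _; rewrite ne //; lia.
have [kS|notin] := boolP (k.+1 \in S); last by apply: (extend 0 0) => kS; rewrite kS in notin.
have ne t : t <= k -> (t == k.+1) = false by move=> tk; apply/eqP; lia.
case: (boolP (far S P k.+1)) => [fark|]; last first.
  rewrite {1}/far ltnS Pk negbK => /hasP[a aS /and3P[Pa Pax xaS]].
  apply: (extend (h a + h (k.+1 - a)) (l a + l (k.+1 - a))) => _.
  rewrite /coord_step; case: ifP => [/andP[_ /hasPn /(_ a aS)]|_].
    by rewrite Pa Pax xaS.
  by exists a, (k.+1 - a); rewrite eqxx !ne; [split=> //; [lia|split=> //; lia]|lia|lia].
have nohigh a b : a \in S -> b \in S -> P <= a -> P <= b -> k.+1 = a + b -> False.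
  move=> aS bS Pa Pb E; move: fark => /andP[_ /hasPn /(_ a aS)].
  have Pax : P + a <= k.+1 by lia.
  have -> : k.+1 - a = b by lia.
  by rewrite Pa Pax bS.
have big : 48 * P < k.+1.
  rewrite ltnNge; apply/negP => small.
  have [|a [b [aS bS Pa Pb E]]] := gen _ kS; first by rewrite ltnS Pk.
  exact: nohigh E.
case: (cS) => _ _ /(_ _ kS)[|[y [z [yS zS E]]]]; first lia.
wlog zy : y z yS zS E / z <= y => [wl|].
  by case: (leqP z y) => ?; [apply: (wl y z)|apply: (wl z y) => //; lia].
have zP : z < P by rewrite ltnNge; apply/negP => Pz; apply: (@nohigh y z) => //; lia.
have z0 := chain_set_gt0 cS zS.
apply: (extend (h y) (l y + z)) => _; rewrite /coord_step fark.
by exists y, z; rewrite eqxx ne; [split=> //; lia|lia].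
Qed.

Lemma ltn_count (T : eqType) (p q : pred T) s x :
  {in s, forall t, p t -> q t} -> x \in s -> q x -> ~~ p x -> count p s < count q s.
Proof.
elim: s => // a s IH sub; rewrite inE /=.
have subs : {in s, forall t, p t -> q t}.
  by move=> t ts; apply: sub; rewrite inE ts orbT.
have le : count p s <= count q s.
  elim: (s) subs => //= b s' IH' subs'; apply: leq_add; last first.
    by apply: IH' => t ts; apply: subs'; rewrite inE ts orbT.
  by have := subs' b (mem_head _ _); case: (p b) => // ->.
case/predU1P => [->|xs] qx px; first by rewrite qx (negbTE px) /=; lia.
have := IH subs xs qx px; have := sub a (mem_head _ _).
by case: (p a) => [->|] //; lia.
Qed.

Lemma coordinates_split S P h l x : chain_set S -> coordinates S P h l ->
  x \in S -> P <= x -> x = h x * P + l x.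
Proof.
move=> cS [hP lP hl]; elim/ltn_ind: x => x IH xS.
rewrite leq_eqVlt => /predU1P[<-|Px]; first by rewrite hP lP mul1n addn0.
have := hl x xS Px; rewrite /coord_step.
case: ifP => _ [y [z [yS zS Py Pz [E -> ->]]]]; have z0 := chain_set_gt0 cS zS.
  by rewrite addnA -IH //; lia.
have y0 := chain_set_gt0 cS yS.
by rewrite mulnDl addnACA -!IH //; lia.
Qed.

Lemma coordinates_gt0 S P h l x : chain_set S -> coordinates S P h l ->
  x \in S -> P <= x -> 0 < h x.
Proof.
move=> cS [hP lP hl]; elim/ltn_ind: x => x IH xS.
rewrite leq_eqVlt => /predU1P[<-|Px]; first by rewrite hP.
have := hl x xS Px; rewrite /coord_step.
case: ifP => _ [y [z [yS zS Py Pz [E -> _]]]]; have z0 := chain_set_gt0 cS zS.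
  by apply: IH => //; lia.
by rewrite addn_gt0 IH //; lia.
Qed.

(** * Bounds on [l] and on the growth of a chain by the number of far elements *)

Definition far_upto S P x := count (fun t => far S P t && (t <= x)) S.
Definition near_upto S P x := count (fun t => ~~ far S P t && (t <= x)) S.

Lemma count_upto (p : pred nat) (S : seq nat) w x : w <= x ->
  count (fun t => p t && (t <= w)) S + (p x && (w < x) && (x \in S)) <=
  count (fun t => p t && (t <= x)) S.
Proof.
move=> wx; case: (boolP (p x && (w < x) && (x \in S))) => [/andP[/andP[px wx' xS]]|_].
  rewrite addn1; apply: (ltn_count (x := x)) => //; rewrite ?px ?leqnn -?ltnNge //.
  by move=> t _ /andP[-> tw]; apply: leq_trans tw wx.
by rewrite addn0; apply: sub_count => t /andP[-> tw]; apply: leq_trans tw wx.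
Qed.

(** A far step adds [r < P] to some [y >= 47 * P], hence at most [x / 47]; at the other steps the
    bounds of the summands add up. *)
Lemma coordinates_bound S P h l x : chain_set S -> coordinates S P h l ->
  x \in S -> P <= x -> 47 * l x <= far_upto S P x * x.
Proof.
move=> cS [hP lP hl]; elim/ltn_ind: x => x IH xS.
rewrite leq_eqVlt => /predU1P[<-|Px]; first by rewrite lP muln0.
have := hl x xS Px; rewrite /coord_step.
case: ifP => fx [y [z [yS zS Py Pz [E _ ->]]]]; have z0 := chain_set_gt0 cS zS.
  have yx : y < x by lia.
  have ly : 47 * l y <= far_upto S P y * y by apply: IH => //; lia.
  have := count_upto (far S P) S (ltnW yx); rewrite fx yx xS addn1 => cyx.
  have : (far_upto S P y).+1 * y <= far_upto S P x * x.
    exact: leq_mul cyx (ltnW yx).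
  by rewrite mulSn mulnDr; clear -ly Py Pz; lia.
have y0 := chain_set_gt0 cS yS.
have yx : y < x by lia.
have zx : z < x by lia.
rewrite {2}E !mulnDr; apply: leq_add.
  apply: leq_trans (IH y yx yS Py) _; rewrite leq_mul2r; apply/orP; right.
  by apply: leq_trans (count_upto _ _ (ltnW yx)); apply: leq_addr.
apply: leq_trans (IH z zx zS Pz) _; rewrite leq_mul2r; apply/orP; right.
by apply: leq_trans (count_upto _ _ (ltnW zx)); apply: leq_addr.
Qed.

Lemma growth_step a b w x c c' g g' : x * a <= b * w -> a < b ->
  2 * w * a ^ c <= 2 ^ g * b ^ c -> c < c' -> g <= g' ->
  2 * x * a ^ c' <= 2 ^ g' * b ^ c'.
Proof.
move=> xw ab IH cc gg; rewrite -(subnKC cc) addSnnS !expnD !expnS.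
have le1 : a ^ (c' - c.+1) <= b ^ (c' - c.+1).
  by case: (c' - c.+1) => // d; rewrite leq_exp2r // ltnW.
have le2 : 2 ^ g <= 2 ^ g' by rewrite leq_exp2l.
have -> : 2 * x * (a ^ c * (a * a ^ (c' - c.+1))) =
          (2 * a ^ c) * (x * a) * a ^ (c' - c.+1) by lia.
have -> : 2 ^ g' * (b ^ c * (b * b ^ (c' - c.+1))) =
          2 ^ g' * b ^ c * b * b ^ (c' - c.+1) by lia.
apply: leq_mul => //; apply: leq_trans (leq_mul (leqnn _) xw) _.
have -> : 2 * a ^ c * (b * w) = 2 * w * a ^ c * b by lia.
by rewrite leq_mul2r; apply/orP; right; apply: leq_trans IH _; rewrite leq_mul2r le2 orbT.
Qed.

Lemma doubling_step a b w x c c' g g' : x <= 2 * w -> a < b ->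
  2 * w * a ^ c <= 2 ^ g * b ^ c -> c <= c' -> g < g' ->
  2 * x * a ^ c' <= 2 ^ g' * b ^ c'.
Proof.
move=> xw ab IH cc gg; rewrite -(subnKC cc) !expnD.
have le1 : a ^ (c' - c) <= b ^ (c' - c).
  by case: (c' - c) => // d; rewrite leq_exp2r // ltnW.
have le2 : 2 * 2 ^ g <= 2 ^ g' by rewrite -expnS leq_exp2l.
rewrite !mulnA; apply: leq_mul => //.
apply: (@leq_trans (2 * (2 * w) * a ^ c)).
  by rewrite leq_mul2r leq_mul2l xw !orbT.
apply: (@leq_trans (2 * (2 ^ g * b ^ c))); first by rewrite -mulnA leq_mul2l IH orbT.
by rewrite mulnA leq_mul2r le2 orbT.
Qed.

(** A far step has ratio at most [48 / 47] and any other at most 2. The factor 2 on the left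
    accounts for the initial 1, which is counted as near. *)
Lemma coordinates_growth S P h l x : chain_set S -> 0 < P -> coordinates S P h l ->
  x \in S -> 2 * x * 47 ^ far_upto S P x <= 2 ^ near_upto S P x * 48 ^ far_upto S P x.
Proof.
move=> cS P0 [hP lP hl]; elim/ltn_ind: x => x IH xS.
case: (boolP (far S P x)) => fx.
  have /andP[Px _] := fx; have := hl x xS Px; rewrite /coord_step fx.
  case=> [y [r [yS rS rP Py [E _ _]]]]; have r0 := chain_set_gt0 cS rS.
  have yx : y < x by lia.
  have := count_upto (far S P) S (ltnW yx); rewrite fx yx xS addn1 => cyx.
  apply: growth_step (IH y yx yS) cyx _ => //; first by lia.
  by apply: leq_trans (count_upto _ _ (ltnW yx)); apply: leq_addr.
have [x1|xn1] := eqVneq x 1.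
  subst x; have -> : far_upto S P 1 = 0.
    apply/eqP; rewrite -leqn0 leqNgt -has_count; apply/hasPn => t _.
    by rewrite /far; case: (leqP t 1) => t1; rewrite ?andbF //; case: (ltnP P t) => //; lia.
  rewrite !expn0 !muln1 -[X in X <= _]expn1 leq_exp2l //.
  by rewrite /near_upto -has_count; apply/hasP; exists 1; rewrite ?fx.
have [w [wS wx x2w]] : exists w, [/\ w \in S, w < x & x <= 2 * w].
  have [_ _ cl] := cS.
  case: (cl x xS) => [x1|[y [z [yS zS E]]]]; first by rewrite x1 in xn1.
  have y0 := chain_set_gt0 cS yS; have z0 := chain_set_gt0 cS zS.
  by case: (leqP y z) => ?; [exists z|exists y]; split=> //; lia.
have := count_upto (fun t => ~~ far S P t) S (ltnW wx); rewrite fx wx xS addn1 => gwx.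
apply: doubling_step x2w _ (IH w wx wS) _ gwx => //.
by apply: leq_trans (count_upto _ _ (ltnW wx)); apply: leq_addr.
Qed.

(** Each far element costs a doubling and gives back only [48 / 47]. As [48 < 94], the bound for all
    far elements implies the one for any smaller number [E]. *)
Lemma growth_total S P h l n E : chain_set S -> 0 < P -> coordinates S P h l ->
  n \in S -> E <= count (far S P) S -> 2 * n * 94 ^ E <= 2 ^ size S * 48 ^ E.
Proof.
move=> cS P0 co nS Eu; set u := count _ _ in Eu.
have cu : far_upto S P n <= u by apply: sub_count => t /andP[].
have gu : near_upto S P n <= size S - u.
  have <- : count (predC (far S P)) S = size S - u by have := count_predC (far S P) S; lia.
  by apply: sub_count => t /andP[].
have uS : u <= size S by exact: count_size.
have main : 2 * n * 47 ^ u <= 2 ^ (size S - u) * 48 ^ u.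
  have := coordinates_growth cS P0 co nS.
  set c := far_upto S P n in cu *; set g := near_upto S P n in gu * => H.
  have splitu b : b ^ u = b ^ c * b ^ (u - c) by rewrite -expnD subnKC.
  rewrite !splitu !mulnA; apply: leq_mul.
    by apply: leq_trans H _; apply: leq_mul => //; rewrite leq_exp2l.
  by case: (u - c) => // d; rewrite leq_exp2r.
have main2 : 2 * n * 94 ^ u <= 2 ^ size S * 48 ^ u.
  have -> : 94 ^ u = 2 ^ u * 47 ^ u by rewrite -expnMn.
  have -> : 2 ^ size S = 2 ^ u * 2 ^ (size S - u) by rewrite -expnD subnKC.
  by rewrite mulnCA -[X in _ <= X]mulnA leq_mul2l main orbT.
have splitE b : b ^ u = b ^ E * b ^ (u - E) by rewrite -expnD subnKC.
rewrite !splitE !mulnA in main2.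
have p48 : 0 < 48 ^ (u - E) by rewrite expn_gt0.
have p94 : 48 ^ (u - E) <= 94 ^ (u - E) by case: (u - E) => // d; rewrite leq_exp2r.
rewrite -(leq_pmul2r p48); apply: leq_trans main2.
by rewrite leq_mul2l p94 orbT.
Qed.

Lemma count3_size (T : Type) (p q r : pred T) (s : seq T) :
  (forall t, p t + q t + r t <= 1) -> count p s + count q s + count r s <= size s.
Proof. by move=> disj; elim: s => //= a s IH; have := disj a; lia. Qed.

(* The chain consists of the elements below [P] and of the [h x * P], which do
   not change at the far [x]. *)
Lemma drop_far S P h l n : chain_set S -> P \in S -> P./2 \in S -> ~~ odd P ->
  coordinates S P h l -> n \in S -> P <= n ->
  exists2 T, chain_set T & h n * P \in T /\ size T + count (far S P) S <= size S.
Proof.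
move=> cS PS P2S evP co nS Pn; have P0 := chain_set_gt0 cS PS.
have P20 := chain_set_gt0 cS P2S.
have PE : P = P./2 + P./2 by rewrite addnn even_halfK.
have [S1 S0 cl] := cS; have [hP lP hl] := co.
set T := [seq x <- S | x < P] ++
         [seq h x * P | x <- [seq x <- S | (P <= x) && ~~ far S P x]].
have lowT x : x \in S -> x < P -> x \in T by rewrite mem_cat mem_filter => -> ->.
(* A far [x] shares its [h] with a smaller element, so the descent ends at an element that is
   kept. *)
have highT x : x \in S -> P <= x -> h x * P \in T.
  elim/ltn_ind: x => x IH xS Px.
  case: (boolP (far S P x)) => fx; last first.
    rewrite mem_cat; apply/orP; right; apply/mapP; exists x => //.
    by rewrite mem_filter xS Px fx.
  have /andP[Px' _] := fx; have := hl x xS Px'; rewrite /coord_step fx.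
  case=> [y [r [yS rS rP Py [E -> _]]]]; have r0 := chain_set_gt0 cS rS.
  by apply: IH => //; clear -E r0 Py; lia.
exists T.
  split; first by apply: lowT => //; lia.
    rewrite mem_cat mem_filter (negbTE S0) andbF /=; apply/mapP => -[x].
    rewrite mem_filter => /andP[/andP[Px _] xS].
    by have := coordinates_gt0 cS co xS Px; lia.
  move=> v; rewrite mem_cat => /orP[|/mapP[x]].
    rewrite mem_filter => /andP[vP vS]; case: (cl v vS) => [|[a [b [aS bS E]]]]; first by left.
    have a0 := chain_set_gt0 cS aS; have b0 := chain_set_gt0 cS bS.
    by right; exists a, b; split=> //; apply: lowT => //; clear -E vP a0 b0; lia.
  rewrite mem_filter => /andP[/andP[Px fx] xS] ->; right.
  move: Px; rewrite leq_eqVlt => /predU1P[<-|Px].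
    by exists P./2, P./2; split; [| |rewrite hP mul1n]; rewrite ?lowT //; clear -PE P20; lia.
  have := hl x xS Px; rewrite /coord_step (negbTE fx).
  case=> [y [z [yS zS Py Pz [E -> _]]]].
  by exists (h y * P), (h z * P); rewrite mulnDl; split=> //; exact: highT.
split; first exact: highT.
rewrite size_cat size_map !size_filter; apply: count3_size => t.
by rewrite /far; case: (ltngtP P t) => //= _; case: (has _ _).
Qed.

(* [P] itself becomes [P./2], which is counted below [P]. *)
Lemma halve_scale S P h l n : chain_set S -> P \in S -> P./2 \in S -> ~~ odd P ->
  coordinates S P h l -> n \in S -> P < n ->
  exists2 T, chain_set T & h n * P./2 + l n \in T /\ size T < size S.
Proof.
move=> cS PS P2S evP co nS Pn; have P0 := chain_set_gt0 cS PS.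
have P20 := chain_set_gt0 cS P2S.
have PE : P = P./2 + P./2 by rewrite addnn even_halfK.
have [S1 S0 cl] := cS; have [hP lP hl] := co.
set T := [seq x <- S | x < P] ++ [seq h x * P./2 + l x | x <- [seq x <- S | P < x]].
have lowT x : x \in S -> x < P -> x \in T by rewrite mem_cat mem_filter => -> ->.
have highT x : x \in S -> P <= x -> h x * P./2 + l x \in T.
  move=> xS; rewrite leq_eqVlt => /predU1P[<-|Px].
    by rewrite hP lP mul1n addn0; apply: lowT => //; lia.
  rewrite mem_cat; apply/orP; right; apply/mapP; exists x => //.
  by rewrite mem_filter xS Px.
exists T.
  split; first by apply: lowT => //; lia.
    rewrite mem_cat mem_filter (negbTE S0) andbF /=; apply/mapP => -[x].
    rewrite mem_filter => /andP[Px xS].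
    by have := coordinates_gt0 cS co xS (ltnW Px); lia.
  move=> v; rewrite mem_cat => /orP[|/mapP[x]].
    rewrite mem_filter => /andP[vP vS]; case: (cl v vS) => [|[a [b [aS bS E]]]]; first by left.
    have a0 := chain_set_gt0 cS aS; have b0 := chain_set_gt0 cS bS.
    by right; exists a, b; split=> //; apply: lowT => //; clear -E vP a0 b0; lia.
  rewrite mem_filter => /andP[Px xS] ->; right.
  have := hl x xS Px; rewrite /coord_step; case: ifP => _ [y [z [yS zS Py Pz [E -> ->]]]].
    exists (h y * P./2 + l y), z; rewrite addnA; split=> //; last exact: lowT.
    by apply: highT => //; clear -Pz; lia.
  exists (h y * P./2 + l y), (h z * P./2 + l z); rewrite mulnDl addnACA.
  by split=> //; exact: highT.
split; first exact: highT nS (ltnW Pn).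
have c1 : 0 < count (pred1 P) S by rewrite -has_count has_pred1.
rewrite size_cat size_map !size_filter.
apply: (@leq_trans (count (fun x => x < P) S + count (fun x => P < x) S + count (pred1 P) S)).
  by rewrite -addn1 leq_add2l.
by apply: count3_size => t; rewrite /= eq_sym; case: ltngtP.
Qed.

(** The form used by the inductions: [u] counts the far elements. Dropping [l] saves [u] elements,
    and halving the scale saves one. *)
Lemma cut_reduce S n P : chain_set S -> n \in S -> cut S n P ->
  exists h l u, [/\ n = h * P + l, 47 * l <= u * n,
    forall E, E <= u -> 2 * n * 94 ^ E <= 2 ^ size S * 48 ^ E,
    exists2 T, chain_set T & h * P \in T /\ size T + u <= size S
    & exists2 T, chain_set T & h * P./2 + l \in T /\ size T < size S].
Proof.
move=> cS nS cutP; have [h [l co]] := cut_coordinates cS cutP.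
have [PS evP P2S Pn _] := cutP; have P0 := chain_set_gt0 cS PS.
have Pn' : P < n by lia.
exists (h n), (l n), (count (far S P) S); split.
- exact: coordinates_split co nS (ltnW Pn').
- apply: leq_trans (coordinates_bound cS co nS (ltnW Pn')) _.
  by rewrite leq_mul2r; apply/orP; right; apply: sub_count => t /andP[].
- by move=> E; exact: growth_total co nS.
- exact: drop_far co nS (ltnW Pn').
- exact: halve_scale co nS Pn'.
Qed.

(** * From unordered sets to the decreasing chains of the search *)

Definition below (S : seq nat) (b : nat) : seq nat := [seq x <- rev (iota 1 b) | x \in S].

Lemma mem_below S b x : x \in below S b = [&& x \in S, 0 < x & x <= b].
Proof. by rewrite mem_filter mem_rev mem_iota add1n ltnS. Qed.

Lemma belowS S b : below S b.+1 = if b.+1 \in S then b.+1 :: below S b else below S b.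
Proof. by rewrite /below -{1}[b.+1]addn1 iotaD rev_cat /= add1n. Qed.

Lemma In_map_of_nat (s : seq nat) x :
  List.In x (map N.of_nat s) <-> exists2 y, y \in s & x = N.of_nat y.
Proof.
elim: s => [|a s IH] /=; first by split=> // -[].
rewrite IH; split=> [[<-|[y ys ->]]|[y]].
- by exists a => //; exact: mem_head.
- by exists y => //; rewrite inE ys orbT.
- by rewrite inE => /predU1P[->|ys] ->; [left|right; exists y].
Qed.

(** The element 1 accounts for [j = 1]; each further element raises [j] if its step is large and [e]
    if it is small. *)
Lemma chain_below S b : chain_set S -> 0 < b ->
  exists j e, chain (map N.of_nat (below S b)) (N.of_nat (2 ^ j)) (N.of_nat e) /\
              size (below S b) = j + e.
Proof.
move=> cS; have [S1 S0 cl] := cS; case: b => // b _; elim: b => [|b [j [e [ch sz]]]].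
  by rewrite belowS S1; exists 1, 0; split=> //; exact: chain1.
rewrite belowS; case: ifP => // bS; last by exists j, e.
case: (cl _ bS) => // -[y [z [yS zS E]]].
have y0 := chain_set_gt0 cS yS; have z0 := chain_set_gt0 cS zS.
have inb t : t \in S -> 0 < t -> t <= b.+1 -> List.In (N.of_nat t) (map N.of_nat (below S b.+1)).
  by move=> tS t0 tb; apply/In_map_of_nat; exists t => //; rewrite mem_below tS t0.
have iny : List.In (N.of_nat y) (map N.of_nat (below S b.+1)) by apply: inb => //; lia.
have inz : List.In (N.of_nat z) (map N.of_nat (below S b.+1)) by apply: inb => //; lia.
have sumE : N.of_nat b.+2 = (N.of_nat y + N.of_nat z)%num by rewrite E Nat2N.inj_add.
have lt t : List.In t (map N.of_nat (below S b.+1)) -> (t < N.of_nat y + N.of_nat z)%num.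
  by move=> /In_map_of_nat[x]; rewrite mem_below => /and3P[_ _ xb] ->; lia.
rewrite map_cons sumE /=.
have [small|big] := ltnP b.+2 (2 ^ j).
  exists j, e.+1; split; last by rewrite sz addnS.
  have -> : N.of_nat e.+1 = (N.of_nat e + 1)%num by lia.
  by apply: chain_small => //; lia.
exists j.+1, e; split; last by rewrite sz addSn.
have -> : N.of_nat (2 ^ j.+1) = (2 * N.of_nat (2 ^ j))%num by rewrite expnS; lia.
by apply: chain_big => //; lia.
Qed.

(** * Lower bounds *)

(** Since [48 * P <= b], the truncation at [b] already shows all elements that the cut condition
    concerns. *)
Lemma cut_of_cut_at S n b P : chain_set S -> b <= n -> 48 * P <= b -> P \in S ->
  cut_at (N.of_nat P) (map N.of_nat (below S b)) = true -> cut S n P.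
Proof.
move=> cS bn Pb PS; have P0 := chain_set_gt0 cS PS; rewrite /cut_at.
case evP : (N.even _) => //; case: ifP => // /memN_P /In_map_of_nat[q].
rewrite mem_below => /and3P[qS q0 qb] qE /allN_P gen.
have /N.even_spec[t tE] := evP.
have PE : P = q + q by move: qE; rewrite tE N.div2_double; lia.
have P2 : P./2 = q by rewrite PE addnn doubleK.
split=> //; [by rewrite PE addnn odd_double|by rewrite P2|exact: leq_trans bn|].
move=> x xS /andP[Px xP].
have inx : List.In (N.of_nat x) (map N.of_nat (below S b)).
  by apply/In_map_of_nat; exists x => //; rewrite mem_below xS; lia.
have := gen _ inx.
have -> : (N.of_nat P <? N.of_nat x)%num = true by apply/N.ltb_spec0; lia.
have -> : (N.of_nat x <=? 48 * N.of_nat P)%num = true by apply/N.leb_spec0; lia.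
move=> /hasN_P[a /In_map_of_nat[a' aS ->]].
case: N.leb_spec => // Pa; case: N.leb_spec => // Pax /memN_P /In_map_of_nat[c cS' cE].
move: aS cS'; rewrite !mem_below => /andP[aS _] /andP[cS' _].
by exists a', c; split=> //; clear -Pa Pax cE; lia.
Qed.

Lemma irreducible_below S n b : chain_set S -> (forall P, ~ cut S n P) -> b <= n ->
  irreducible (map N.of_nat (below S b)).
Proof.
move=> cS nocut; elim: b => [|b IH] bn //.
have := @cut_of_cut_at S n b.+1; rewrite belowS; case: ifP => bS cutof; last exact: IH (ltnW bn).
split; last exact: IH (ltnW bn).
move=> P; rewrite -map_cons => /In_map_of_nat[p pin ->] Pb.
apply: contrapT => /eqP; case cutE : (cut_at _ _) => // _.
apply: (nocut p); apply: cutof => //; first by lia.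
by move: pin; rewrite inE mem_below => /predU1P[->|/andP[]].
Qed.

Lemma size_below S b : size (below S b) <= size S.
Proof.
apply: uniq_leq_size; first by rewrite filter_uniq // rev_uniq iota_uniq.
by move=> x; rewrite mem_below => /andP[].
Qed.

Lemma chain_of_set S n : chain_set S -> n \in S ->
  exists l j e, [/\ chain (N.of_nat n :: l) (N.of_nat (2 ^ j)) (N.of_nat e),
    size l < size S, j + e <= size S, n < 2 ^ j <= 2 * n
    & (forall P, ~ cut S n P) -> irreducible (N.of_nat n :: l)].
Proof.
move=> cS nS; have n0 := chain_set_gt0 cS nS.
have [j [e [ch sz]]] := chain_below cS n0.
have irr := fun nocut => @irreducible_below S n n cS nocut (leqnn n).
move: ch irr; have <- : n.-1.+1 = n by rewrite prednK.
have nE : n.-1.+1 = n by rewrite prednK.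
rewrite belowS nE nS /= => ch irr; exists (map N.of_nat (below S n.-1)), j, e.
have lt := chain_lt ch (or_introl erefl); have [_ ge] := chain_top ch.
change (top (N.of_nat n :: map N.of_nat (below S n.-1))) with (N.of_nat n) in ge.
have szn : j + e <= size S by rewrite -sz; exact: size_below.
have szl : size (below S n) = (size (below S n.-1)).+1 by rewrite -{1}nE belowS nE nS.
split=> //; first by rewrite size_map -szl; exact: size_below.
by apply/andP; split; clear -lt ge; lia.
Qed.

Lemma pow2_eq j k y : 16 * 2 ^ k < y < 32 * 2 ^ k -> y < 2 ^ j -> 2 ^ j <= 2 * y ->
  j = k + 5.
Proof.
have p4 : 2 ^ (k + 4) = 16 * 2 ^ k by rewrite expnD mulnC.
have p6 : 2 ^ (k + 6) = 64 * 2 ^ k by rewrite expnD mulnC.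
move=> /andP[lo hi] yj jy; case: (ltngtP j (k + 5)) => // jk.
  have : 2 ^ j <= 2 ^ (k + 4) by rewrite leq_exp2l //; lia.
  by rewrite p4; clear -lo yj; lia.
have : 2 ^ (k + 6) <= 2 ^ j by rewrite leq_exp2l //; lia.
by rewrite p6; clear -hi jy; lia.
Qed.

(* As [2 ^ (k + 4) < y < 2 ^ (k + 5)], a chain of size [k + 6] has one small step. *)
Lemma one_small_step S y k : chain_set S -> y \in S ->
  21 * 2 ^ k < y -> 10 * y < 234 * 2 ^ k -> k + 7 <= size S.
Proof.
elim/ltn_ind: y S k => y IH S k cS yS lo hi; rewrite leqNgt; apply/negP => small.
have [[P cutP]|nocut] := EM (exists P, cut S y P).
  have [h [l [u [yE lu grow _ [T cT [inT szT]]]]]] := cut_reduce cS yS cutP.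
  have [_ evP _ Py _] := cutP; have P0 := chain_set_gt0 cS (let: And5 PS _ _ _ _ := cutP in PS).
  (* One far element would give [188 * y <= 3072 * 2 ^ k], which is too small; without any,
     [y = h * P] can be halved. *)
  case: u lu grow => [|u] lu grow; last first.
    have := grow 1 isT; have : 2 ^ size S <= 2 ^ (k + 6) by rewrite leq_exp2l //; lia.
    by rewrite expnD (_ : 2 ^ 6 = 64) // !expn1; clear -lo; lia.
  have l0 : l = 0 by clear -lu; lia.
  case: k lo hi small => [|k] lo hi small; first by clear -hi Py P0; lia.
  have half_y : y = 2 * (h * P./2 + l).
    by rewrite {1}yE l0 !addn0 -{1}[P]even_halfK // -muln2; clear; lia.
  have := IH (h * P./2 + l) _ T k cT inT.
  rewrite expnS in lo hi; clear -half_y lo hi small szT l0 Py P0.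
  by move=> /(_ ltac:(lia) ltac:(lia) ltac:(lia)); lia.
have [L [j [e [ch _ je /andP[yj jy] irr]]]] := chain_of_set cS yS.
have jE : j = k + 5 by apply: pow2_eq yj jy; apply/andP; split; lia.
have e1 : e <= 1 by clear -je jE small; lia.
have := irreducible_range ch (irr (fun P c => nocut (ex_intro _ P c))) ltac:(lia).
rewrite /range_check; change (top (N.of_nat y :: L)) with (N.of_nat y).
rewrite jE expnD (_ : 2 ^ 5 = 32) //.
have -> : (N.of_nat e <? 2)%num = true by apply/N.ltb_spec0; lia.
case: N.ltb_spec => [_|]; last by clear -lo; lia.
case: N.ltb_spec => [_|]; last by clear -hi; lia.
by case: N.eqb_spec => [|//]; clear -e1; lia.
Qed.

Lemma chain_reaches l pw e : chain l pw e ->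
  forall r n, reaches l r n -> reaches [:: 1%num] (r + (size l).-1) n.
Proof.
elim=> {l pw e} [r n|l pw e a b ch IH al bl lt _ r n re|l pw e a b ch IH al bl lt _ r n re].
- by rewrite addn0.
- have sl : size l = (size l).-1.+1 by case: (l) al.
  by rewrite /= sl addnS -addSn; apply: IH; exact: reachesS re.
- have sl : size l = (size l).-1.+1 by case: (l) al.
  by rewrite /= sl addnS -addSn; apply: IH; exact: reachesS re.
Qed.

Lemma chain_head_reaches n l pw e : chain (n :: l) pw e -> n <> 1%num ->
  exists2 r, r < size l & reaches [:: 1%num] r n.
Proof.
move: {-2}(n :: l) (erefl (n :: l)) => L LE ch.
case: ch LE => [[<- _]//|{}L {}pw {}e a b ch al bl lt _
  |{}L {}pw {}e a b ch al bl lt _] [<- <-] _;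
  exists (0 + (size L).-1); try (by case: (L) al); exact: chain_reaches ch _ _ (reaches0 al bl lt).
Qed.

Lemma unreachable_size S n k : 1 < n -> odd n -> unreachable (N.of_nat n) k ->
  chain_set S -> n \in S -> k + 2 <= size S.
Proof.
move=> n1 on un cS nS; rewrite leqNgt; apply/negP => small.
have [l [j [e [ch szl _ _ _]]]] := chain_of_set cS nS.
have [|r rl re] := chain_head_reaches ch; first by lia.
move: un; rewrite /unreachable => /forallb_forall /(_ r) /=.
have rk : List.In r (List.seq 0 k) by apply/in_seq; lia.
move=> /(_ rk); rewrite (reach_complete re) //=.
- by apply/N.odd_spec; exists (N.of_nat n./2); lia.
- by left.
- by move=> y [<-|[]].
Qed.

(** The constant 22.51 is just below [23 * 46 / 47], what remains of [23 * 2 ^ k] when one far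
    element is dropped. *)
Lemma two_small_steps S y k : chain_set S -> y \in S ->
  2251 * 2 ^ k < 100 * y -> 10 * y < 234 * 2 ^ k -> size S <= k + 7 -> y = 23 * 2 ^ k.
Proof.
elim/ltn_ind: y S k => y IH S k cS yS lo hi small.
have [[P cutP]|nocut] := EM (exists P, cut S y P).
  have [h [l [u [yE lu grow [T1 cT1 [inT1 szT1]] [T cT [inT szT]]]]]] := cut_reduce cS yS cutP.
  have [_ evP _ Py _] := cutP; have P0 := chain_set_gt0 cS (let: And5 PS _ _ _ _ := cutP in PS).
  case: u lu grow szT1 => [|[|u]] lu grow szT1.
  - have l0 : l = 0 by clear -lu; lia.
    case: k lo hi small => [|k] lo hi small; first by clear -hi Py P0; lia.
    have half_y : y = 2 * (h * P./2 + l).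
      by rewrite {1}yE l0 !addn0 -{1}[P]even_halfK // -muln2; clear; lia.
    have := IH (h * P./2 + l) _ T k cT inT.
    rewrite expnS in lo hi *; clear -half_y lo hi small szT l0 Py P0.
    by move=> /(_ ltac:(lia) ltac:(lia) ltac:(lia) ltac:(lia)); lia.
  (* As [47 * l <= y], the number [h * P] stays above [21 * 2 ^ k], and its chain is shorter by
     one. *)
  - have := one_small_step cT1 inT1 (k := k).
    have p0 : 0 < 2 ^ k by rewrite expn_gt0.
    clear -yE lu lo hi small szT1 p0; move: (h * P) (2 ^ k) p0 yE lo hi => z p p0 yE lo hi.
    by move=> /(_ ltac:(lia) ltac:(lia)); lia.
  - have := grow 2 isT; have : 2 ^ size S <= 2 ^ (k + 7) by rewrite leq_exp2l.
    by rewrite expnD (_ : 2 ^ 7 = 128) // !expnS !expn0; clear -lo; lia.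
have [L [j [e [ch _ je /andP[yj jy] irr]]]] := chain_of_set cS yS.
have jE : j = k + 5 by apply: pow2_eq yj jy; apply/andP; split; lia.
have e2 : e <= 2 by clear -je jE small; lia.
have := irreducible_range ch (irr (fun P c => nocut (ex_intro _ P c))) ltac:(lia).
rewrite /range_check; change (top (N.of_nat y :: L)) with (N.of_nat y).
rewrite jE expnD (_ : 2 ^ 5 = 32) //.
case: N.ltb_spec => [_|]; last by case: ifP; clear -lo; lia.
case: N.ltb_spec => [_|]; last by clear -hi; lia.
by case: N.eqb_spec => // _ /N.eqb_spec; clear; lia.
Qed.

(** Given a cut, the number of far elements decides: none makes the target even, one leads back to
    the target for the preceding exponent, two contradict [one_small_step], and three make the chain
    grow too slowly. *)
Lemma target_bound m S : 5 <= m -> chain_set S -> 23 * 2 ^ m + 7 \in S -> m + 9 <= size S.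
Proof.
elim: m S => [//|m IH] S m5 cS nS; rewrite leqNgt; apply/negP => small.
have [m4|m6] : m = 4 \/ 5 <= m by clear -m5; lia.
  rewrite m4 in nS small; have /and5P[_ _ _ _ un] := unreachable_true.
  have := @unreachable_size S 743 12 isT isT un cS nS.
  by clear -small; lia.
have {m5} p32 : 32 <= 2 ^ m by rewrite (_ : 32 = 2 ^ 5) // leq_exp2l.
have [[P cutP]|nocut] := EM (exists P, cut S (23 * 2 ^ m.+1 + 7) P).
  have [h [l [u [nE lu grow [T1 cT1 [inT1 szT1]] [T cT [inT szT]]]]]] := cut_reduce cS nS cutP.
  have [_ evP _ Pn _] := cutP.
  have P0 := chain_set_gt0 cS (let: And5 PS _ _ _ _ := cutP in PS).
  have hPE : h * P = 2 * (h * P./2) by rewrite -{1}[P]even_halfK // -muln2; clear; lia.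
  case: u lu grow szT1 => [|[|[|u]]] lu grow szT1.
  - by move: nE; rewrite hPE expnS; clear -lu; lia.
  (* Dropping the far element leaves exactly [23 * 2 ^ m.+1], so [l = 7], and halving the scale
     gives the preceding target. *)
  - have hE := two_small_steps cT1 inT1 (k := m.+1).
    have {}hE : h * P = 23 * 2 ^ m.+1.
      clear -hE nE lu p32 small szT1; rewrite expnS in hE nE lu *.
      by apply: hE; lia.
    have := IH T m6 cT; rewrite (_ : 23 * 2 ^ m + 7 = h * P./2 + l); last first.
      by move: nE hE; rewrite hPE expnS; clear; lia.
    by move=> /(_ inT); clear -szT small; lia.
  - have := one_small_step cT1 inT1 (k := m.+1).
    clear -nE lu p32 small szT1; rewrite expnS in nE lu *.
    by move=> /(_ ltac:(lia) ltac:(lia)); lia.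
  - have := grow 3 isT; have : 2 ^ size S <= 2 ^ (m + 9) by rewrite leq_exp2l //; lia.
    by rewrite expnD (_ : 2 ^ 9 = 512) // !expnS !expn0; clear -p32; lia.
have [L [j [e [ch _ je /andP[nj jn] irr]]]] := chain_of_set cS nS.
have jE : j = m.+1 + 5.
  by apply: pow2_eq nj jn; rewrite expnS; clear -p32; lia.
have e3 : e <= 3 by clear -je jE small; lia.
have := @irreducible_target _ _ _ (N.of_nat (2 ^ m.+1)) ch (irr (fun P c => nocut (ex_intro _ P c))).
apply; first by clear -e3; lia.
- by rewrite expnS; clear -p32; lia.
- by rewrite expnS; apply/N.even_spec; exists (N.of_nat (2 ^ m)); clear; lia.
- by rewrite jE expnD (_ : 2 ^ 5 = 32) //; clear; lia.
- by change (top (N.of_nat (23 * 2 ^ m.+1 + 7) :: L)) with (N.of_nat (23 * 2 ^ m.+1 + 7)); clear; lia.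
Qed.

(** * Star chains *)

Lemma chain_set_of_ell n : 0 < n ->
  exists S, [/\ chain_set S, n \in S & size S = (ell n).+1].
Proof.
move=> /ellP[[a [a0 an pos step] sz] _].
have a_gt0 : 0 < size a by case: (a) a0.
exists a; split; last by rewrite -sz prednK.
- split=> [||x /(nthP 0)[i ia <-]].
  + by rewrite -a0 mem_nth.
  + by apply/negP => /(nthP 0)[i ia i0]; have := pos i ia; rewrite i0.
  + case: i ia => [|i] ia; first by left.
    have [j [k [ji ki E]]] := step i.+1 ia; right; exists (nth 0 a j), (nth 0 a k).
    by split=> //; apply: mem_nth; apply: ltn_trans ia.
- by rewrite -an -nth_last mem_nth // prednK.
Qed.

(** Elements above [n] are discarded and the rest sorted without repetition; summands, being
    smaller, then come earlier. *)
Lemma ell_lt_size (S : seq nat) (n : nat) : chain_set S -> n \in S -> ell n < size S.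
Proof.
move=> cS nS; have n0 := chain_set_gt0 cS nS; have [S1 S0 Sadd] := cS.
pose a := [seq x <- iota 1 n | x \in S].
have aE x : (x \in a) = (x \in S) && (0 < x <= n) by rewrite mem_filter mem_iota add1n ltnS.
have asort : sorted ltn a by apply: sorted_filter (iota_ltn_sorted 1 n); exact: ltn_trans.
have na : n \in a by rewrite aE nS n0 leqnn.
have a_gt0 : 0 < size a by case: (a) na.
have szS : size a <= size S.
  apply: uniq_leq_size => [|x]; first by rewrite filter_uniq // iota_uniq.
  by rewrite aE => /andP[].
have lt_nth i j : i < size a -> j < size a -> (nth 0 a i < nth 0 a j) = (i < j).
  move=> ia ja; have mono := sorted_ltn_nth ltn_trans 0 asort.
  case: (ltngtP i j) => [ij|ji|->]; last exact: ltnn.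
    exact: mono.
  by apply/negbTE; rewrite -leqNgt ltnW //; exact: mono.
have ea : (size a).-1 < size a by rewrite prednK.
have [_ /(_ (size a).-1)] := ellP n0.
suff ch : addition_chain n a by move=> /(_ (ex_intro2 _ _ a ch erefl)); lia.
split=> [||k ka|k /andP[k0 ka]].
- by rewrite /a; case: (n) n0 => // m _; rewrite /= S1.
- have [i ia iE] := nthP 0 na; rewrite -nth_last.
  have := mem_nth 0 ea; rewrite aE => /and3P[_ _].
  rewrite -{1}iE leqNgt lt_nth // => ilt.
  by rewrite -iE; congr nth; apply/anti_leq; rewrite leqNgt ilt -ltnS prednK.
- by have := mem_nth 0 ka; rewrite aE => /and3P[].
have := mem_nth 0 ka; rewrite aE => /and3P[aS ak0 an].
have ka1 : 0 < size a by [].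
have a1 : nth 0 a 0 < nth 0 a k by rewrite lt_nth.
have := mem_nth 0 ka1; rewrite aE => /and3P[_ a00 _].
have [E|[y [z [yS zS E]]]] := Sadd _ aS; first by rewrite E ltnNge a00 in a1.
have y0 := chain_set_gt0 cS yS; have z0 := chain_set_gt0 cS zS.
have /(nthP 0)[i ia iE] : y \in a by rewrite aE yS y0 (leq_trans _ an) // E leq_addr.
have /(nthP 0)[j ja jE] : z \in a by rewrite aE zS z0 (leq_trans _ an) // E leq_addl.
exists i, j; split; last by rewrite iE jE.
- by rewrite -(lt_nth i k ia ka) iE E -{1}[y]addn0 ltn_add2l.
- by rewrite -(lt_nth j k ja ka) jE E -{1}[z]add0n ltn_add2r.
Qed.

Inductive star : seq nat -> Prop :=
| star1 : star [:: 1]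
| starS a b l : star (a :: l) -> b \in a :: l -> star (a + b :: a :: l).

Lemma pred_pow2_add a b : 2 ^ b * (2 ^ a - 1) + (2 ^ b - 1) = 2 ^ (a + b) - 1.
Proof.
have a0 : 0 < 2 ^ a by rewrite expn_gt0.
have b0 : 0 < 2 ^ b by rewrite expn_gt0.
by rewrite expnD; nia.
Qed.

(* A step [a + b] of the star chain costs the [b] doublings that lead from
   [2 ^ a - 1] to [2 ^ b * (2 ^ a - 1)] and one addition. *)
Lemma star_pred_pow2 l : star l -> exists S,
  [/\ chain_set S, forall x, x \in l -> 2 ^ x - 1 \in S
    & size S + 1 = head 0 l + size l].
Proof.
elim=> {l} [|a b l st [S [cS inS szS]] bl].
  exists [:: 1]; split=> // [|x]; last by rewrite inE => /eqP ->.
  by split=> // x; rewrite inE => /eqP ->; left.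
have doubling j : exists S', [/\ chain_set S', {subset S <= S'},
    2 ^ j * (2 ^ a - 1) \in S' & size S' = size S + j].
  elim: j => [|j [S' [cS' sub jS' sz]]].
    by exists S; split=> //; rewrite ?mul1n ?addn0 // inS ?mem_head.
  have [S1 S0 Sadd] := cS'.
  exists (2 ^ j.+1 * (2 ^ a - 1) :: S'); split=> [|x /sub xS||].
  - split=> [||x].
    + by rewrite inE S1 orbT.
    + rewrite inE negb_or S0 andbT.
      have := chain_set_gt0 cS' jS'; rewrite expnS; lia.
    + rewrite inE => /predU1P[->|/Sadd[->|[y [z [yS zS ->]]]]]; [right|by left|right].
        exists (2 ^ j * (2 ^ a - 1)), (2 ^ j * (2 ^ a - 1)).
        by rewrite inE jS' orbT; split=> //; rewrite expnS; lia.
      by exists y, z; rewrite !inE yS zS !orbT.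
  - by rewrite inE xS orbT.
  - by rewrite mem_head.
  - by rewrite /= sz !addnS.
have [S' [cS' sub bS' sz]] := doubling b; have [S1 S0 Sadd] := cS'.
exists (2 ^ (a + b) - 1 :: S'); split=> [|x|]; last by move: szS; rewrite /= sz; lia.
- split=> [||x].
  + by rewrite inE S1 orbT.
  + rewrite inE negb_or S0 andbT -pred_pow2_add.
    by have := chain_set_gt0 cS' bS'; lia.
  + rewrite inE => /predU1P[->|/Sadd[->|[y [z [yS zS ->]]]]]; [right|by left|right].
      exists (2 ^ b * (2 ^ a - 1)), (2 ^ b - 1).
      by rewrite !inE bS' sub ?inS // !orbT pred_pow2_add.
    by exists y, z; rewrite !inE yS zS !orbT.
- by rewrite inE => /predU1P[->|/inS/sub xS]; rewrite inE ?eqxx ?xS ?orbT.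
Qed.

(** [size l] is the length of the star chain, and the set obtained for [2 ^ n - 1] has size
    [n + size l]. *)
Lemma scholz_of_star n l : star (n :: l) -> size l <= ell n -> scholz n.
Proof.
move=> st ln; have [S [cS inS szS]] := star_pred_pow2 st.
have := ell_lt_size cS (inS n (mem_head n l)).
by rewrite /scholz; move: szS => /=; lia.
Qed.

Lemma star_cons x a l : star (a :: l) -> a <= x -> x - a \in a :: l ->
  star (x :: a :: l).
Proof. by move=> st ax; rewrite -{2}(subnKC ax); exact: starS. Qed.

Lemma star_target m : exists2 l, star (23 * 2 ^ m + 7 :: l) & size l = m + 8.
Proof.
have [l st [l7 sz]] : exists2 l, star (23 * 2 ^ m :: l) & 7 \in l /\ size l = m + 7.
  elim: m => [|m [l st [l7 sz]]].
    (* This star chain for 23 passes through 7, the summand of the final step. *)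
    exists [:: 16; 8; 7; 4; 3; 2; 1]; last by [].
    by do !(apply: star_cons => //); exact: star1.
  exists (23 * 2 ^ m :: l); last by rewrite inE l7 orbT /= sz.
  by rewrite expnS mulnCA mul2n -addnn; apply: starS; rewrite ?mem_head.
exists (23 * 2 ^ m :: l); last by rewrite /= sz !addnS.
by apply: starS; rewrite // inE l7 orbT.
Qed.

Lemma ell_ge n k : 0 < n -> (forall S, chain_set S -> n \in S -> k < size S) -> k <= ell n.
Proof.
by move=> /chain_set_of_ell[S [cS nS sz]] /(_ S cS nS); rewrite sz.
Qed.

Lemma ell_unreachable n N k : N.of_nat n = N -> unreachable N k -> 1 < n -> odd n ->
  k < ell n.
Proof.
move=> <- un n1 on; apply: ell_ge => [|S cS nS]; first exact: ltnW.
by have := unreachable_size n1 on un cS nS; rewrite addn2.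
Qed.

Lemma ell_small : [/\ 8 <= ell 53, 8 <= ell 99, 11 <= ell 191 & 11 <= ell 375].
Proof.
have /and5P[un53 un99 un191 un375 _] := unreachable_true.
split.
- exact: (@ell_unreachable 53 53%num 7).
- exact: (@ell_unreachable 99 99%num 7).
- exact: (@ell_unreachable 191 191%num 10).
- exact: (@ell_unreachable 375 375%num 10).
Qed.

Theorem theorem6 : forall m : nat, 1 <= m -> scholz (23 * 2 ^ m + 7).
Proof.
move=> m m1; have [m5|m4] := leqP 5 m.
  have [l st sz] := star_target m; apply: scholz_of_star st _.
  rewrite sz; apply: ell_ge => [|S cS nS]; first by rewrite addn_gt0 orbT.
  by have := target_bound m5 cS nS; rewrite !addnS.
have [ell53 ell99 ell191 ell375] := ell_small.
(* For [m = 3] the general star chain has the optimal length 11; the other three values have star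
   chains one or two steps shorter than [m + 8]. *)
have [->|[->|[->|->]]] : m = 1 \/ m = 2 \/ m = 3 \/ m = 4 by clear -m1 m4; lia.
- have st : star [:: 53; 52; 48; 32; 16; 8; 4; 2; 1].
    by do !(apply: star_cons => //); exact: star1.
  exact: scholz_of_star st ell53.
- have st : star [:: 99; 66; 33; 32; 16; 8; 4; 2; 1].
    by do !(apply: star_cons => //); exact: star1.
  exact: scholz_of_star st ell99.
- by have [l st sz] := star_target 3; apply: scholz_of_star st _; rewrite sz.
- have st : star [:: 375; 250; 125; 100; 50; 25; 24; 16; 8; 4; 2; 1].
    by do !(apply: star_cons => //); exact: star1.
  exact: scholz_of_star st ell375.
Qed.
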